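(* $\mathsf{Eqv}(\mathsf{NMatr})$ is undecidable; that is, there is no algorithm that, given a finite signature $\Sigma$ and two finite $\Sigma$-Nmatrices $\mathbb{M}_1,\mathbb{M}_2$, determines whether $\vdash_{\mathbb{M}_1}=\vdash_{\mathbb{M}_2}$.
   Context: A signature $\Sigma$ is a family $\{\Sigma^{(k)}:k\in\mathbb{N}_0\}$ of sets of connectives indexed by arity; it is finite if it has only finitely many connectives in total. $P=\{p_i:i\in\mathbb{N}\}$ is the set of propositional variables, and $L_\Sigma(P)$ is the set of formulas built from $P$ using connectives in $\Sigma$. A $\Sigma$-Nmatrix (non-deterministic matrix) is a triple $\mathbb{M}=\langle V,D,\cdot_{\mathbb{M}}\rangle$ with $V$ a non-empty set of truth-values, $D\subseteq V$ the designated values, and, for each $c\in\Sigma^{(k)}$, a multi-function $c_{\mathbb{M}}:V^k\to 2^V\setminus\{\emptyset\}$. It is finite if both $V$ and $\Sigma$ are finite. A valuation of $\mathbb{M}$ is a function $v:L_\Sigma(P)\to V$ with $v(c(A_1,\dots,A_k))\in c_{\mathbb{M}}(v(A_1),\dots,v(A_k))$ for all $k\in\mathbb{N}_0$, $c\in\Sigma^{(k)}$ and formulas $A_1,\dots,A_k$. For $\Gamma\cup\{A\}\subseteq L_\Sigma(P)$, $\Gamma\vdash_{\mathbb{M}}A$ iff every valuation $v$ of $\mathbb{M}$ with $v(\Gamma)\subseteq D$ satisfies $v(A)\in D$. $\mathsf{NMatr}$ is the class of all finite Nmatrices, and $\mathsf{Eqv}(\mathsf{NMatr})$ is the problem: given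 a finite signature $\Sigma$ and finite $\Sigma$-Nmatrices $\mathbb{M}_1,\mathbb{M}_2$, determine whether $\vdash_{\mathbb{M}_1}=\vdash_{\mathbb{M}_2}$. Finite signatures and Nmatrices are given under any standard finite encoding. *)

(* Defs.v *)
From HB Require Import structures.
From mathcomp Require Import all_boot.
Set Implicit Arguments.
Unset Strict Implicit.
Unset Printing Implicit Defensive.

(* A finite signature: Sigma^(k) is the fibre [set c | arity c == k]. *)
Record signature := Signature {
  conn :> finType;
  arity : conn -> nat
}.

Inductive formula (S : signature) : Type :=
| Var of nat
| App (c : S) of {ffun 'I_(arity c) -> formula S}.

Record nmatrix (S : signature) := Nmatrix {
  value : finType;
  designated : {set value};
  interp : forall c : S, (arity c).-tuple value -> {set value};
  value_neq0 : 0 < #|value|;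
  interp_neq0 : forall (c : S) (t : (arity c).-tuple value), interp t != set0
}.

Definition valuation S (M : nmatrix S) (v : formula S -> value M) : Prop :=
  forall (c : S) (A : {ffun 'I_(arity c) -> formula S}),
    v (App A) \in interp [tuple v (A i) | i < arity c].

(* The set of premises G is arbitrary, possibly infinite. *)
Definition entails S (M : nmatrix S) (G : formula S -> Prop) (A : formula S) :
  Prop :=
  forall v : formula S -> value M, valuation v ->
    (forall B, G B -> v B \in designated M) -> v A \in designated M.

Definition same_entailment S (M1 M2 : nmatrix S) : Prop :=
  forall (G : formula S -> Prop) (A : formula S),
    entails M1 G A <-> entails M2 G A.

(* All k-tuples over T, in lexicographic order with respect to enum T (the
   enumeration of k.-tuple T as a finType is opaque). *)
Fixpoint lex_tuples (T : finType) (k : nat) : seq (k.-tuple T) :=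
  match k with
  | 0 => [:: [tuple]]
  | k'.+1 => [seq cons_tuple x t | x <- enum T, t <- lex_tuples T k']
  end.

(* Finite encoding. Connectives and truth-values are listed in the order of
   the enumerations of their finTypes, and CodeSeq.code is a computable
   bijection from seq nat to nat. Subsets are given by their characteristic
   bits, and the multi-function of a k-ary connective by the k+1-dimensional
   table of the bits (x \in interp t), with x varying fastest. *)
Definition signature_code (S : signature) : nat :=
  CodeSeq.code [seq arity c | c <- enum S].

Definition interp_code S (M : nmatrix S) (c : S) : nat :=
  CodeSeq.code [seq nat_of_bool (x \in interp t)
               | t <- lex_tuples (value M) (arity c), x <- enum (value M)].

Definition nmatrix_code S (M : nmatrix S) : nat :=
  CodeSeq.code
    [:: #|value M|;
        CodeSeq.code [seq nat_of_bool (x \in designated M)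
                     | x <- enum (value M)];
        CodeSeq.code [seq interp_code M c | c <- enum S]].

Definition instance_code S (M1 M2 : nmatrix S) : nat :=
  CodeSeq.code [:: signature_code S; nmatrix_code M1; nmatrix_code M2].

(* Algorithms are partial recursive functions; murec n is the type of
   definitions of n-ary ones. *)
Inductive murec : nat -> Type :=
| Zero n : murec n
| Succ : murec 1
| Proj n (i : 'I_n) : murec n
| Comp m n (f : murec m) (g : 'I_m -> murec n) : murec n
| Prec n (f : murec n) (g : murec n.+2) : murec n.+1
| Mu n (f : murec n.+1) : murec n.

(* eval f x y: the partial function f is defined at x, with value y. In the
   case of primitive recursion, on the first argument, h is the sequence of
   values from 0 to that argument; in the case of minimization, f must be
   defined at all arguments below y. *)
Fixpoint eval n (f : murec n) : n.-tuple nat -> nat -> Prop :=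
  match f in murec n return n.-tuple nat -> nat -> Prop with
  | Zero _ => fun _ y => y = 0
  | Succ => fun x y => y = (thead x).+1
  | Proj _ i => fun x y => y = tnth x i
  | Comp m _ f g => fun x y =>
      exists2 z : m.-tuple nat, forall i, eval (g i) x (tnth z i) & eval f z y
  | Prec _ f g => fun x y =>
      exists h : nat -> nat,
        [/\ eval f [tuple of behead x] (h 0),
            forall i, i < thead x ->
              eval g [tuple of i :: h i :: behead x] (h i.+1)
          & y = h (thead x)]
  | Mu _ f => fun x y =>
      eval f [tuple of y :: x] 0 /\
      forall i, i < y -> exists z, eval f [tuple of i :: x] z.+1
  end.

(* Main.v *)
Require Import Defs.
From HB Require Import structures.
From mathcomp Require Import all_boot.
From mathcomp Require Import boolp.
Set Implicit Arguments.
Unset Strict Implicit.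
Unset Printing Implicit Defensive.

(** The proof is a diagonal argument on top of an encoding of computations
  by formulas.

  The graph of a partial recursive function is definable by finitely many
  Horn clauses over the natural numbers whose only constraints are x = 0 and
  x = y + 1 ([representableP]).  Fix such clauses P, a predicate goal and a
  number n.  There is an Nmatrix [logic P N goal true n] in which some
  formula is always designated exactly when goal(n) is derivable from P.
  Formulas are read as numerals (connectives zero and successor) or as
  derivations (one connective for each clause, applied to the values of the
  variables of the clause and to derivations of its body).  Finitely many
  truth-values cannot compare terms, but all valuations together can: every
  truth-value has an own bit, which is 0 at zero and is chosen freely at
  every other formula, so that two formulas are equal as soon as their own
  bits agree in all valuations ([own_observe_inj]).  A truth-value also
  records the own bit of the predecessor, or the predicate and the own bits
  of the arguments of the fact derived; a clause connective with wrong
  children in a valuation is unconstrained there.  Hence a fact is derivable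
  if some formula has the kind of a derivation of this fact in all
  valuations ([derivable_observed]), and conversely the encoding of a
  derivation has this property ([derivable_formula]).

  The number n enters only through the arity of one more connective, which
  must be applied to 1, 2, ..., n and a derivation of goal(n).  When these
  children are right in a valuation its result must be designated.  Being
  designated is independent of the rest of the truth-value and otherwise
  free, so if goal(n) is not derivable then G entails only the members of G
  ([entails_trivial]).  This is also what happens in
  [logic P N goal false n], where the last connective is unconstrained.
  Hence the two Nmatrices are equivalent exactly when goal(n) is not
  derivable ([same_entailmentP]).

  In the code of the pair of Nmatrices, everything but n.+1 and the tables
  of the last connective is constant in n.  One number e gathers these
  constants, together with the transition table of an automaton that
  recognizes the right children, and one total recursive function, the same
  for all P, computes the code from e and n ([computable_assemble],
  [wide_instance_code]).  If f decided equivalence, the function that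
  searches forever at e unless f answers yes on the pair given by e and
  n = e would be partial recursive.  Taking for P its clauses and for e the
  corresponding constants, this function halts at e if and only if the two
  Nmatrices are equivalent, if and only if it does not halt at e. *)

(** * Partial recursive functions *)

Lemma eval_fun n (f : murec n) x y y' : eval f x y -> eval f x y' -> y = y'.
Proof.
elim: f x y y' => {n} /=.
- by move=> n x y y' -> ->.
- by move=> x y y' -> ->.
- by move=> n i x y y' -> ->.
- move=> m n f IHf g IHg x y y' [z gz fz] [z' gz' fz'].
  suff E : z = z' by move: fz'; rewrite -E; apply: IHf.
  by apply: eq_from_tnth => i; apply: IHg (gz i) (gz' i).
- move=> n f IHf g IHg x y y' [h [h0 hS ->]] [h' [h0' hS' ->]].
  have E i : i <= thead x -> h i = h' i.
    elim: i => [|i IH] lt_ix; first exact: IHf h0 h0'.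
    have := hS' i lt_ix; rewrite -IH ?(ltnW lt_ix) //.
    exact: IHg (hS i lt_ix).
  exact: E.
- move=> n f IHf x y y' [fy lty] [fy' lty'].
  case: (ltngtP y y') => // lt_y.
    by have [z fz] := lty' y lt_y; have := IHf _ _ _ fy fz.
  by have [z fz] := lty y' lt_y; have := IHf _ _ _ fy' fz.
Qed.

(** The arguments are taken as a sequence, so that a function can be built by
  composing expressions in [nth 0 x i]; only sequences of length n matter. *)
Definition computable n (F : seq nat -> nat) :=
  exists f : murec n, forall x : n.-tuple nat, eval f x (F x).

Lemma eq_computable n (F G : seq nat -> nat) :
  (forall x : n.-tuple nat, F x = G x) -> computable n F -> computable n G.
Proof. by move=> FG [f fP]; exists f => x; rewrite -FG. Qed.

Lemma computable_nth n i : i < n -> computable n (nth 0 ^~ i).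
Proof. by move=> lt_in; exists (Proj (Ordinal lt_in)) => x /=; rewrite (tnth_nth 0). Qed.

Lemma computable_comp m n F (G : nat -> seq nat -> nat) :
  computable m F -> (forall i, i < m -> computable n (G i)) ->
  computable n (fun x => F (mkseq (G^~ x) m)).
Proof.
move=> [f fP] Gc.
have /fin_all_exists[g gP] : forall i : 'I_m, exists g : murec n,
    forall x : n.-tuple nat, eval g x (G i x) by move=> i; apply: Gc.
exists (Comp f g) => x; exists [tuple G i x | i < m] => [i|].
  by rewrite tnth_mktuple.
suff -> : mkseq (G^~ x) m = [tuple G i x | i < m] by [].
by rewrite /mkseq -val_enum_ord -map_comp.
Qed.

Lemma computable_succ n F : computable n F -> computable n (fun x => (F x).+1).
Proof.
move=> Fc; have Sc : computable 1 (fun x => (head 0 x).+1).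
  by exists Succ => x /=; case/tupleP: x.
exact: (computable_comp (G := fun=> F) Sc).
Qed.

Lemma computable_const n c : computable n (fun=> c).
Proof. by elim: c => [|c]; [exists (Zero n) | apply: computable_succ]. Qed.

(** Weakening: under a primitive recursion the two additional arguments, the
  index and the previous value, come first. *)
Lemma computable_drop2 n F :
  computable n F -> computable n.+2 (fun x => F (drop 2 x)).
Proof.
move=> Fc; apply: (@eq_computable _ (fun x => F (mkseq (fun i => nth 0 x i.+2) n))).
  move=> x; congr F; apply: (@eq_from_nth _ 0).
    by rewrite size_mkseq size_drop size_tuple subn2.
  by rewrite size_mkseq => i lt_in; rewrite nth_mkseq // nth_drop.
apply: (computable_comp (G := fun i => nth 0 ^~ i.+2)) => // i lt_in.
exact: computable_nth.
Qed.

(** Primitive recursion whose step function may refer to the arguments of the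
  enclosing function. *)
Lemma computable_iteri n A B G :
  computable n A -> computable n B ->
  computable n.+2 (fun x => G (nth 0 x 0) (nth 0 x 1) (drop 2 x)) ->
  computable n (fun x => iteri (A x) (fun i r => G i r x) (B x)).
Proof.
move=> Ac [b bP] [g gP].
have Rc : computable n.+1 (fun x =>
    iteri (head 0 x) (fun i r => G i r (behead x)) (B (behead x))).
  exists (Prec b g) => x; case/tupleP: x => a x /=.
  exists (fun k => iteri k (fun i r => G i r x) (B x)); split=> [|i _|].
  - suff -> : [tuple of behead [tuple of a :: x]] = x by apply: bP.
    exact: val_inj.
  - set y := [tuple of _]; have := gP y.
    by rewrite /= drop0.
  - by rewrite theadE.
(* The number of iterations is passed as an additional first argument. *)
pose H i (x : seq nat) := if i is j.+1 then nth 0 x j else A x.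
apply: eq_computable (computable_comp (G := H) Rc _) => [x|[|i] lt_i //].
  have E : [seq H i x | i <- iota 1 n] = x.
    apply: (@eq_from_nth _ 0) => [|i]; rewrite size_map size_iota ?size_tuple //.
    by move=> lt_in; rewrite (nth_map 0) ?size_iota // nth_iota.
  by rewrite /= E.
exact: computable_nth.
Qed.

Section Arithmetic.
Variables (n : nat) (A B : seq nat -> nat).
Hypotheses (Ac : computable n A) (Bc : computable n B).

Let Aw : computable n.+2 (fun x => A (drop 2 x)) := computable_drop2 Ac.

Lemma computable_add : computable n (fun x => A x + B x).
Proof.
apply: (@eq_computable _ (fun x => iteri (B x) (fun _ r => r.+1) (A x))).
  by move=> x; elim: (B x) => [|b /= ->]; rewrite ?addn0 ?addnS.
apply: (computable_iteri (G := fun _ r _ => r.+1)) => //.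
by apply: computable_succ; apply: computable_nth.
Qed.

Lemma computable_pred : computable n (fun x => (A x).-1).
Proof.
apply: (@eq_computable _ (fun x => iteri (A x) (fun i _ => i) 0)).
  by move=> x; case: (A x).
apply: (computable_iteri (G := fun i _ _ => i) (B := fun=> 0)) => //.
  exact: computable_const.
exact: computable_nth.
Qed.

Lemma computable_if0 C : computable n C ->
  computable n (fun x => if C x == 0 then A x else B x).
Proof.
move=> Cc; apply: (@eq_computable _ (fun x => iteri (C x) (fun _ _ => B x) (A x))).
  by move=> x; case: (C x).
apply: (computable_iteri (G := fun _ _ x => B x)) => //.
exact: computable_drop2.
Qed.

End Arithmetic.

Lemma computable_mul n A B : computable n A -> computable n B ->
  computable n (fun x => A x * B x).
Proof.
move=> Ac Bc.
apply: (@eq_computable _ (fun x => iteri (B x) (fun _ r => r + A x) 0)).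
  by move=> x; elim: (B x) => [|b /= ->]; rewrite ?muln0 // mulnS addnC.
apply: (computable_iteri (G := fun _ r x => r + A x) (B := fun=> 0)) => //.
  exact: computable_const.
by apply: computable_add; [apply: computable_nth | apply: computable_drop2].
Qed.

Lemma computable_exp n A B : computable n A -> computable n B ->
  computable n (fun x => A x ^ B x).
Proof.
move=> Ac Bc.
apply: (@eq_computable _ (fun x => iteri (B x) (fun _ r => r * A x) 1)).
  by move=> x; elim: (B x) => [|b /= ->]; rewrite // expnS mulnC.
apply: (computable_iteri (G := fun _ r x => r * A x) (B := fun=> 1)) => //.
  exact: computable_const.
by apply: computable_mul; [apply: computable_nth | apply: computable_drop2].
Qed.

Lemma computable_sub n A B : computable n A -> computable n B ->
  computable n (fun x => A x - B x).
Proof.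
move=> Ac Bc.
apply: (@eq_computable _ (fun x => iteri (B x) (fun _ r => r.-1) (A x))).
  by move=> x; elim: (B x) => [|b /= ->]; rewrite ?subn0 // subnS.
apply: (computable_iteri (G := fun _ r _ => r.-1)) => //.
by apply: computable_pred; apply: computable_nth.
Qed.

Lemma computable_mod n A B : computable n A -> computable n B ->
  computable n (fun x => A x %% B x).
Proof.
move=> Ac Bc; pose step r d := if d - r.+1 == 0 then 0 else r.+1.
apply: (@eq_computable _ (fun x =>
    iteri (A x) (fun _ r => if B x == 0 then r.+1 else step r (B x)) 0)).
  move=> x; elim: (A x) => [|a /= ->]; first by rewrite mod0n.
  case: eqP => [->|/eqP]; first by rewrite !modn0.
  rewrite -lt0n => B_gt0; rewrite /step modnS subn_eq0.
  have := ltn_pmod a B_gt0; have := divn_eq a (B x).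
  set q := _ %/ _; set r := _ %% _ => -> lt_r.
  have -> : (B x %| (q * B x + r).+1) = (B x <= r.+1); last by [].
  rewrite -addnS dvdn_addr ?dvdn_mull //; apply/idP/idP => [/dvdn_leq -> //|le_r].
  by rewrite (_ : r.+1 = B x) //; apply/eqP; rewrite eqn_leq lt_r.
apply: (computable_iteri (B := fun=> 0)
  (G := fun _ r x => if B x == 0 then r.+1 else step r (B x))) => //.
  exact: computable_const.
have Rc : computable n.+2 (fun x => (nth 0 x 1).+1).
  by apply: computable_succ; apply: computable_nth.
have Bw := computable_drop2 Bc.
apply: computable_if0 => //.
by apply: computable_if0 => //; [apply: computable_const | apply: computable_sub].
Qed.

Lemma computable_div n A B : computable n A -> computable n B ->
  computable n (fun x => A x %/ B x).
Proof.
move=> Ac Bc.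
apply: (@eq_computable _ (fun x =>
    iteri (A x) (fun i r => if i.+1 %% B x == 0 then r.+1 else r) 0)).
  move=> x; case: (posnP (B x)) => [->|B_gt0].
    by elim: (A x) => [|a /= ->] //; rewrite modn0.
  elim: (A x) => [|a /= ->]; first by rewrite div0n.
  by rewrite divnS // /dvdn; case: ifP.
apply: (computable_iteri (B := fun=> 0)
  (G := fun i r x => if i.+1 %% B x == 0 then r.+1 else r)) => //.
  exact: computable_const.
have Rc : computable n.+2 (fun x => nth 0 x 1) by apply: computable_nth.
apply: computable_if0 => //; first exact: computable_succ.
apply: computable_mod; last exact: computable_drop2.
by apply: computable_succ; apply: computable_nth.
Qed.

(** * Arithmetic of codes *)

Definition code_cons a m := 2 ^ a * m.*2.+1.

(** The 2-adic valuation, as the last i for which 2 ^ i divides c; the bound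
  c on i is generous. *)
Definition code_head c :=
  iteri c (fun i r => if c %% 2 ^ i.+1 == 0 then i.+1 else r) 0.

Definition code_tail c := c %/ 2 ^ (code_head c).+1.

Lemma code_headK a m : code_head (code_cons a m) = a.
Proof.
have le_ac : a <= code_cons a m.
  by rewrite (leq_trans (ltnW (ltn_expl a (ltnSn 1)))) // leq_pmulr.
have E k : (2 ^ k %| code_cons a m) = (k <= a).
  rewrite /code_cons Gauss_dvdl ?dvdn_Pexp2l //.
  by case: k => [|k]; rewrite ?coprime1n // coprime_pexpl // coprime2n /= odd_double.
suff H k : iteri k (fun i r => if code_cons a m %% 2 ^ i.+1 == 0 then i.+1 else r) 0
   = minn k a by rewrite /code_head H; apply/minn_idPr.
elim: k => [|k /= ->]; first by rewrite min0n.
rewrite -[_ == 0]/(_ %| _) E; case: ltnP => [lt_ka|le_ak].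
  by apply/esym/minn_idPl.
by rewrite !(minn_idPr _) // leqW.
Qed.

Lemma code_tailK a m : code_tail (code_cons a m) = m.
Proof.
rewrite /code_tail code_headK /code_cons expnSr divnMA mulKn ?expn_gt0 //.
by rewrite divn2 -[m.*2.+1]addn1 halfD odd_double doubleK addn0.
Qed.

Lemma computable_code_cons n A B : computable n A -> computable n B ->
  computable n (fun x => code_cons (A x) (B x)).
Proof.
move=> Ac Bc; apply: computable_mul.
  by apply: computable_exp => //; apply: computable_const.
apply: computable_succ; apply: eq_computable (computable_add Bc Bc) => x.
exact: addnn.
Qed.

Lemma computable_code_head n A : computable n A ->
  computable n (fun x => code_head (A x)).
Proof.
move=> Ac; apply: (computable_iteri (B := fun=> 0) (G := fun i r x =>
  if A x %% 2 ^ i.+1 == 0 then i.+1 else r)) => //.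
  exact: computable_const.
have Ic : computable n.+2 (fun x => (nth 0 x 0).+1).
  by apply: computable_succ; apply: computable_nth.
apply: computable_if0 => //; first exact: computable_nth.
apply: computable_mod; first exact: computable_drop2.
by apply: computable_exp => //; apply: computable_const.
Qed.

Lemma computable_code_tail n A : computable n A ->
  computable n (fun x => code_tail (A x)).
Proof.
move=> Ac; apply: computable_div => //.
apply: computable_exp; first exact: computable_const.
by apply: computable_succ; apply: computable_code_head.
Qed.

Definition code_nth c i := code_head (iteri i (fun=> code_tail) c).

Lemma code_nthE s i : i < size s -> code_nth (CodeSeq.code s) i = nth 0 s i.
Proof.
rewrite /code_nth => lt_is.
have -> : iteri i (fun=> code_tail) (CodeSeq.code s) = CodeSeq.code (drop i s).
  elim: i lt_is => [|i IH] lt_is; first by rewrite drop0.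
  by rewrite /= IH ?(ltnW lt_is) // (drop_nth 0 (ltnW lt_is)) /= code_tailK.
by rewrite (drop_nth 0 lt_is) /= code_headK.
Qed.

Lemma computable_code_nth n A B : computable n A -> computable n B ->
  computable n (fun x => code_nth (A x) (B x)).
Proof.
move=> Ac Bc; apply: computable_code_head.
apply: (computable_iteri (G := fun _ r _ => code_tail r)) => //.
by apply: computable_code_tail; apply: computable_nth.
Qed.

(** A code is built from its last element, hence the reversed index. *)
Definition code_mkseq g k := iteri k (fun i c => code_cons (g (k - i.+1)) c) 0.

Lemma code_mkseqE g k : code_mkseq g k = CodeSeq.code (mkseq g k).
Proof.
suff H i : i <= k -> iteri i (fun i c => code_cons (g (k - i.+1)) c) 0
    = CodeSeq.code [seq g j | j <- iota (k - i) i].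
  by rewrite /code_mkseq H // subnn.
elim: i => // i IH lt_ik.
by rewrite /= IH ?(ltnW lt_ik) // subnSK.
Qed.

(** * Tables of automata *)

Lemma mkseqD (T : Type) (g : nat -> T) a b :
  mkseq g (a + b) = mkseq g a ++ mkseq (fun j => g (a + j)) b.
Proof. by rewrite /mkseq iotaD map_cat add0n -[in iota a](addn0 a) iotaDl -map_comp. Qed.

Lemma mkseq_mul (T : Type) (g : nat -> T) a b :
  mkseq g (a * b) = flatten (mkseq (fun i => mkseq (fun j => g (i * b + j)) b) a).
Proof.
elim: a => [//|a IH]; rewrite mulSnr mkseqD IH -[a.+1]addn1 mkseqD flatten_cat /=.
by rewrite addn0 cats0.
Qed.

(** The state reached from s on the k digits of j in base b, most significant
  first. *)
Definition run (g : nat -> nat -> nat) b k j s :=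
  iteri k (fun i s => g ((j %/ b ^ (k - i.+1)) %% b) s) s.

Section Runs.
Variables (V : finType) (step : nat -> V -> nat).
Variable v0 : V.
Let K := #|V|.
Let istep i s := step s (nth v0 (enum V) i).

Let enumE : enum V = mkseq (nth v0 (enum V)) K.
Proof. by rewrite /K cardE mkseq_nth. Qed.

Let iteri_shift (T : Type) k (f : nat -> T -> T) x :
  iteri k.+1 f x = iteri k (fun i => f i.+1) (f 0 x).
Proof. by elim: k => //= k <-. Qed.

(** The j-th tuple in lexicographic order is spelled by the digits of j in
  base #|V|. *)
Lemma lex_tuples_run k s :
  [seq foldl step s t | t : k.-tuple V <- lex_tuples V k]
  = mkseq (fun j => run istep K k j s) (K ^ k).
Proof.
have K_gt0 : 0 < K by apply/card_gt0P; exists v0.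
elim: k s => [//|k IH] s /=.
rewrite expnS mkseq_mul map_allpairs enumE /allpairs_dep /mkseq -map_comp.
congr flatten; apply/eq_in_map => i; rewrite mem_iota /= add0n => lt_iK.
rewrite -[in LHS]/(istep i s).
transitivity [seq foldl step (istep i s) t | t : k.-tuple V <- lex_tuples V k] => //.
rewrite IH; apply/eq_in_map => j; rewrite mem_iota /= add0n => lt_j.
rewrite /run iteri_shift /= subn1 /=.
have KX_gt0 m : 0 < K ^ m by rewrite expn_gt0 K_gt0.
rewrite (divnMDl _ _ (KX_gt0 k)) (divn_small lt_j) addn0 (modn_small lt_iK).
have E h h' (x : nat) :
    (forall i s, i < k -> h i s = h' i s) -> iteri k h x = iteri k h' x.
  by elim: k {IH j lt_j} => //= k IH hE; rewrite IH ?hE // => l t lt_l; apply/hE/leqW.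
apply: E => l t lt_lk; congr (istep _ t).
have -> : i * K ^ k = i * K ^ l * K * K ^ (k - l.+1).
  by rewrite -(mulnA i) -expnSr -mulnA -expnD subnKC.
by rewrite subSS (divnMDl _ _ (KX_gt0 _)) modnMDl.
Qed.

Lemma lex_tuples_table (T : Type) (B : nat -> V -> T) k s :
  [seq B (foldl step s (t : k.-tuple V)) x | t <- lex_tuples V k, x <- enum V]
  = mkseq (fun j => B (run istep K k (j %/ K) s) (nth v0 (enum V) (j %% K)))
          (K ^ k * K).
Proof.
have K_gt0 : 0 < K by apply/card_gt0P; exists v0.
rewrite mkseq_mul /allpairs_dep.
have -> : [seq [seq B (foldl step s t) x | x <- enum V]
              | t : k.-tuple V <- lex_tuples V k]
    = [seq [seq B q x | x <- enum V]
          | q <- [seq foldl step s t | t : k.-tuple V <- lex_tuples V k]].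
  by rewrite -map_comp.
rewrite lex_tuples_run /mkseq -map_comp; congr flatten; apply/eq_map => i /=.
rewrite [in LHS]enumE /mkseq -map_comp; apply/eq_in_map => j.
rewrite mem_iota /= add0n => lt_jK.
by rewrite divnMDl // (divn_small lt_jK) addn0 modnMDl (modn_small lt_jK).
Qed.

End Runs.

(** * Nmatrices with one connective of varying arity *)

(** The automaton that constrains the connective of arity n.+1 has the
  states 0, ..., 4. *)
Notation nstates := 5 (only parsing).
Notation start := 3 (only parsing).

Section WideFamily.
Variables (C : finType) (ar : C -> nat) (V : finType) (D : {set V}).
Variable itp : forall c, (ar c).-tuple V -> {set V}.
Hypothesis itp_neq0 : forall c t, @itp c t != set0.
Variables (step : nat -> V -> nat) (v0 : V).
Hypothesis step_v0 : forall s, step s v0 != 0.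

Definition wide_signature n :=
  @Signature (option C) (fun c => if c is Some c then ar c else n.+1).

(** The automaton reads the arguments and then the result, which it rejects
  by moving to 0; the flag b tells whether it is consulted. *)
Definition wide_interp b n (c : wide_signature n) :
    (arity c).-tuple V -> {set V} :=
  match c return (@arity (wide_signature n) c).-tuple V -> {set V} with
  | Some c => @itp c
  | None => fun t => [set x | b ==> (step (foldl step start t) x != 0)]
  end.

Lemma wide_interp_neq0 b n c t : @wide_interp b n c t != set0.
Proof.
case: c t => [c|] t; first exact: itp_neq0.
by apply/set0Pn; exists v0; rewrite inE step_v0 implybT.
Qed.

Lemma wide_value_neq0 : 0 < #|V|.
Proof. by apply/card_gt0P; exists v0. Qed.

Definition wide_nmatrix b n :=
  Nmatrix D wide_value_neq0 (@wide_interp_neq0 b n).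

(** The part of the code of an instance that does not depend on n, with the
  transition table of the automaton at the end. *)
Definition wide_blueprint := CodeSeq.code
  [:: #|V|,
      CodeSeq.code [seq ar c | c <- enum C],
      CodeSeq.code [seq nat_of_bool (x \in D) | x <- enum V],
      CodeSeq.code [seq CodeSeq.code [seq nat_of_bool (x \in itp t)
                       | t <- lex_tuples V (ar c), x <- enum V] | c <- enum C]
    & mkseq (fun i => step (i %% nstates) (nth v0 (enum V) (i %/ nstates)))
            (#|V| * nstates)].
End WideFamily.

(** [assemble] recovers the code of an instance from its blueprint e and from
  n.  The entries 0, 1, 2, 3 of e are #|V|, the other arities, the designated
  values and the other tables; the transition table of the automaton, with
  [nstates] entries for each letter, starts at entry 4. *)
Section Assemble.
Variables e n : nat.
Let K := code_nth e 0.
Definition entry i s := code_nth e (4 + (i * nstates + s)).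
Definition table_bit j :=
  if entry (j %% K) (run entry K n.+1 (j %/ K) start) == 0 then 0 else 1.
Definition nmatrix_with g := CodeSeq.code
  [:: K; code_nth e 2;
      code_cons (code_mkseq g (K ^ n.+1 * K)) (code_nth e 3)].
Definition assemble := CodeSeq.code
  [:: code_cons n.+1 (code_nth e 1);
      nmatrix_with table_bit; nmatrix_with (fun=> 1)].
End Assemble.

(** In the diagonal argument the blueprint is its own input. *)
Lemma computable_assemble : computable 1 (fun x => assemble (nth 0 x 0) (nth 0 x 0)).
Proof.
pose e x := nth 0 x 0.
have ec m : computable m.+1 e by apply: computable_nth.
have nthc m A i : computable m A -> computable m (fun x => code_nth (A x) i).
  by move=> Ac; apply: computable_code_nth => //; apply: computable_const.
have entryc m A I S : computable m A -> computable m I -> computable m S ->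
    computable m (fun x => entry (A x) (I x) (S x)).
  move=> Ac Ic Sc; apply: computable_code_nth => //.
  apply: (computable_add (A := fun=> 4)); first exact: computable_const.
  apply: computable_add => //; apply: computable_mul => //.
  exact: computable_const.
have bitc m A N J : computable m A -> computable m N -> computable m J ->
    computable m (fun x => table_bit (A x) (N x) (J x)).
  move=> Ac Nc Jc; have Kc := nthc _ _ 0 Ac.
  apply: computable_if0; [exact: computable_const|exact: computable_const|].
  apply: (entryc) => //; first exact: computable_mod.
  apply: (computable_iteri (B := fun=> start) (G := fun i s x => entry (A x)
    ((J x %/ code_nth (A x) 0 %/ code_nth (A x) 0 ^ ((N x).+1 - i.+1))
       %% code_nth (A x) 0) s)); [exact: computable_succ|exact: computable_const|].
  pose Kw x := code_nth (A (drop 2 x)) 0.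
  have Kwc : computable m.+2 Kw by apply: computable_drop2 Kc.
  apply: (entryc); [exact: computable_drop2| |exact: computable_nth].
  apply: (computable_mod (B := Kw)) => //.
  apply: computable_div.
    exact: (computable_drop2 (computable_div Jc Kc)).
  apply: (computable_exp (A := Kw)) => //; apply: computable_sub.
    exact: (computable_drop2 (computable_succ Nc)).
  by apply: computable_succ; apply: computable_nth.
have tabc m A N g : computable m A -> computable m N ->
    (forall J, computable m.+2 J ->
       computable m.+2 (fun x => g (A (drop 2 x)) (N (drop 2 x)) (J x))) ->
    computable m (fun x => nmatrix_with (A x) (N x) (g (A x) (N x))).
  move=> Ac Nc gc; have Kc := nthc _ _ 0 Ac.
  have Lc : computable m (fun x => code_nth (A x) 0 ^ (N x).+1 * code_nth (A x) 0).
    by apply: computable_mul => //; apply: computable_exp => //; apply: computable_succ.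
  apply: computable_code_cons => //; apply: computable_code_cons; first exact: (nthc).
  apply: (computable_code_cons (B := fun=> 0)); last exact: computable_const.
  apply: computable_code_cons; last exact: (nthc).
  apply: (computable_iteri (B := fun=> 0) (G := fun i c x => code_cons (g (A x) (N x)
    (code_nth (A x) 0 ^ (N x).+1 * code_nth (A x) 0 - i.+1)) c)) => //.
    exact: computable_const.
  apply: computable_code_cons; last exact: computable_nth.
  apply: gc; apply: computable_sub; first exact: (computable_drop2 Lc).
  by apply: computable_succ; apply: computable_nth.
apply: computable_code_cons.
  by apply: computable_code_cons; [apply: computable_succ|apply: (nthc)].
apply: computable_code_cons.
  apply: (tabc _ e e table_bit) => // J Jc; apply: (bitc) => //;
  exact: (computable_drop2 (ec 0)).
apply: (computable_code_cons (B := fun=> 0)); last exact: computable_const.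
by apply: (tabc _ e e (fun _ _ _ => 1)) => // J Jc; apply: computable_const.
Qed.

Section WideCode.
Variables (C : finType) (ar : C -> nat) (V : finType) (D : {set V}).
Variable itp : forall c, (ar c).-tuple V -> {set V}.
Hypothesis itp_neq0 : forall c t, @itp c t != set0.
Variables (step : nat -> V -> nat) (v0 : V).
Hypothesis step_v0 : forall s, step s v0 != 0.
Hypothesis step_lt : forall s v, step s v < nstates.

Let M := wide_nmatrix D itp_neq0 step_v0.
Let e := wide_blueprint D itp step v0.

Let enum_option : enum {: option C} = None :: [seq Some c | c <- enum C].
Proof. by rewrite [LHS]enumT unlock [in RHS]enumT. Qed.

Let V_gt0 : 0 < #|V|.
Proof. by apply/card_gt0P; exists v0. Qed.

Let entryE i s : i < #|V| -> s < nstates -> entry e i s = step s (nth v0 (enum V) i).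
Proof.
move=> lt_i lt_s; have lt_k : i * nstates + s < #|V| * nstates.
  by apply: (@leq_trans (i.+1 * nstates)); rewrite ?leq_mul2r // mulSn addnC ltn_add2r.
rewrite /entry code_nthE /= ?size_mkseq ?ltnS //.
by rewrite nth_mkseq // modnMDl modn_small // divnMDl // divn_small // addn0.
Qed.

Let runE k j s : s < nstates -> run (entry e) #|V| k j s < nstates /\
  run (entry e) #|V| k j s = run (fun i s => step s (nth v0 (enum V) i)) #|V| k j s.
Proof.
move=> lt_s; pose d i := (j %/ #|V| ^ (k - i.+1)) %% #|V|.
suff runE l : iteri l (fun i => entry e (d i)) s < nstates /\
    iteri l (fun i => entry e (d i)) s
    = iteri l (fun i s => step s (nth v0 (enum V) (d i))) s by exact: runE.
by elim: l => //= l [lt5 <-]; rewrite entryE ?ltn_pmod.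
Qed.

Let table_bitE n j : table_bit e n j =
  nat_of_bool (step (run (fun i s => step s (nth v0 (enum V) i)) #|V| n.+1 (j %/ #|V|) start)
    (nth v0 (enum V) (j %% #|V|)) != 0).
Proof.
have Ke : code_nth e 0 = #|V| by rewrite code_nthE.
rewrite /table_bit Ke; have [|lt5 <-] := @runE n.+1 (j %/ #|V|) start; first by [].
by rewrite entryE ?ltn_pmod //; case: eqP.
Qed.

(** The connective of varying arity comes first in the enumeration of
  [option C], so its data are prepended to constant sequences. *)
Lemma wide_instance_code n :
  instance_code (M true n) (M false n) = assemble e n.
Proof.
have NM b : nmatrix_code (M b n) = nmatrix_with e n (if b then table_bit e n else fun=> 1).
  rewrite /nmatrix_code /nmatrix_with code_mkseqE !code_nthE //=.
  congr (code_cons _ (code_cons _ (code_cons _ 0))).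
  rewrite enum_option /= -map_comp; congr (code_cons (CodeSeq.code _) _).
  transitivity [seq nat_of_bool (b ==> (step (foldl step start (t : n.+1.-tuple V)) x != 0))
      | t <- lex_tuples V n.+1, x <- enum V].
    by apply: eq_allpairs => t x; rewrite inE.
  rewrite (lex_tuples_table step v0 (fun s x => nat_of_bool (b ==> (step s x != 0)))).
  by apply/eq_map => j; case: b => //; rewrite table_bitE.
rewrite /instance_code !NM /assemble; congr CodeSeq.code; congr (_ :: _).
rewrite /signature_code code_nthE //= enum_option /= -map_comp.
by [].
Qed.
End WideCode.

(** * Horn clauses over the natural numbers *)

(** The variables of a clause are numbers.  An element i of [zeros] is the
  constraint x_i = 0, and an element (i, j) of [succs] is the constraint
  x_i = x_j + 1. *)
Record clause := Clause {
  head_pred : nat;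
  head_args : seq nat;
  zeros : seq nat;
  succs : seq (nat * nat);
  body : seq (nat * seq nat)
}.

Definition clause_tuple c :=
  (head_pred c, head_args c, zeros c, succs c, body c).
Definition tuple_clause t :=
  let: (p, a, z, s, b) := t in Clause p a z s b.
Lemma clause_tupleK : cancel clause_tuple tuple_clause.
Proof. by case. Qed.

HB.instance Definition _ := Countable.copy clause (can_type clause_tupleK).

Inductive derivable (P : seq clause) : nat -> seq nat -> Prop :=
| Derive c (env : nat -> nat) :
    c \in P ->
    (forall i, i \in zeros c -> env i = 0) ->
    (forall ij, ij \in succs c -> env ij.1 = (env ij.2).+1) ->
    (forall b, b \in body c -> derivable P b.1 [seq env i | i <- b.2]) ->
    derivable P (head_pred c) [seq env i | i <- head_args c].

Definition fires P c env :=
  [/\ forall i, i \in zeros c -> env i = 0,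
      forall ij, ij \in succs c -> env ij.1 = (env ij.2).+1
    & forall b, b \in body c -> derivable P b.1 [seq env i | i <- b.2]].

(** Programs are built bottom-up: the predicates in use are below N, and new
  clauses define the predicate N, so that the meaning of the previous
  predicates does not change. *)
Definition preds_lt N (P : seq clause) :=
  forall c, c \in P ->
    head_pred c < N /\ forall b, b \in body c -> b.1 < N.

Definition extends P N P' N' :=
  [/\ preds_lt N' P', N <= N'
    & forall p a, p < N -> derivable P' p a <-> derivable P p a].

Lemma extends_refl P N : preds_lt N P -> extends P N P N.
Proof. by move=> PN; split. Qed.

Lemma extends_trans P1 N1 P2 N2 P3 N3 :
  extends P1 N1 P2 N2 -> extends P2 N2 P3 N3 -> extends P1 N1 P3 N3.
Proof.
move=> [_ le12 E12] [lt3 le23 E23]; split=> // [|p a lt_p].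
  exact: leq_trans le23.
by rewrite E23 ?E12 // (leq_trans lt_p).
Qed.

Lemma derivableP P p a : derivable P p a <->
  exists c env, [/\ c \in P, head_pred c = p, [seq env i | i <- head_args c] = a
                  & fires P c env].
Proof.
split=> [[c env cP z s b]|[c [env [cP <- <- [z s b]]]]]; first by exists c, env.
exact: Derive.
Qed.

Definition defines N (D : seq clause) :=
  forall c, c \in D ->
    head_pred c = N /\ forall b, b \in body c -> b.1 <= N.

Lemma extends_cat P N D : preds_lt N P -> defines N D ->
  extends P N (P ++ D) N.+1.
Proof.
move=> PN DN; split=> // [c|p a lt_p].
  rewrite mem_cat => /orP[/PN[lt_c lt_b]|/DN[-> le_b]]; split=> // [|b /lt_b].
    exact: leqW.
  exact: leqW.
split=> d; last first.
  elim: d {lt_p} => c env cP z s _ IH; apply: Derive => //.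
  by rewrite mem_cat cP.
elim: d lt_p => c env cPD z s _ IH lt_c.
have cP : c \in P.
  by move: cPD; rewrite mem_cat => /orP[//|/DN[Ec _]]; rewrite Ec ltnn in lt_c.
by apply: Derive => // b bc; apply: IH => //; have [_] := PN c cP; apply.
Qed.

Lemma derivable_new P N D a : preds_lt N P -> defines N D ->
  derivable (P ++ D) N a <->
  exists c env, [/\ c \in D, [seq env i | i <- head_args c] = a
                  & fires (P ++ D) c env].
Proof.
move=> PN DN; rewrite derivableP; split=> [] [c [env]].
  case=> + Ec Ea Fc; rewrite mem_cat => /orP[/PN[]|cD].
    by rewrite Ec ltnn.
  by exists c, env.
case=> cD Ea Fc; exists c, env; split=> //; first by rewrite mem_cat cD orbT.
by have [] := DN c cD.
Qed.

(** * Horn definitions of partial recursive functions *)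

(** The value comes first, then the arguments. *)
Definition represents P p n (f : murec n) :=
  forall (x : n.-tuple nat) y, derivable P p (y :: x) <-> eval f x y.

Lemma represents_extends P N P' N' p n (f : murec n) :
  extends P N P' N' -> p < N -> represents P p f -> represents P' p f.
Proof. by move=> [_ _ E] lt_p Pf x y; rewrite E. Qed.

(** In the clauses below, variable 0 is the value, variables 1, ..., n are the
  arguments, and the auxiliary variables come after them. *)
Lemma map_nth_prefix (y : nat) (x z : seq nat) n : size x = n ->
  [seq nth 0 (y :: x ++ z) i | i <- iota 1 n] = x.
Proof.
move=> <-; rewrite map_nth_iota /= ?size_cat ?subn1 ?leq_addr //.
by rewrite drop0 take_size_cat.
Qed.

Lemma map_nth_suffix (y : nat) (x z : seq nat) n m : size x = n -> size z = m ->
  [seq nth 0 (y :: x ++ z) i | i <- iota n.+1 m] = z.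
Proof.
move=> <- <-; rewrite map_nth_iota /= ?size_cat ?subSS ?addKn //.
by rewrite drop_size_cat // take_size.
Qed.

Lemma nth_suffix (y : nat) (x z : seq nat) n i : size x = n ->
  nth 0 (y :: x ++ z) (n.+1 + i) = nth 0 z i.
Proof. by move=> <- /=; rewrite nth_cat ltnNge leq_addr /= addKn. Qed.

(** Any program can be extended by a definition of f, so that the definitions
  of several functions can be stacked. *)
Definition representable n (f : murec n) := forall P N, preds_lt N P ->
  exists P' N' p, [/\ extends P N P' N', p < N' & represents P' p f].

Lemma representable_define n (f : murec n) P N P1 N1 D :
  extends P N P1 N1 -> defines N1 D -> represents (P1 ++ D) N1 f ->
  exists P' N' p, [/\ extends P N P' N', p < N' & represents P' p f].
Proof.
move=> ext1 DN Pf; have [PN1 _ _] := ext1.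
exists (P1 ++ D), N1.+1, N1; split=> //.
exact: extends_trans ext1 (extends_cat PN1 DN).
Qed.

Lemma representable_zero n : representable (Zero n).
Proof.
move=> P N PN; pose c := Clause N (iota 0 n.+1) [:: 0] [::] [::].
have DN : defines N [:: c] by move=> c'; rewrite inE => /eqP->.
apply: (representable_define (extends_refl PN) DN) => x y.
rewrite derivable_new //; split=> [[c' [env [+ + [z _ _]]]]|/= ->].
  by rewrite inE => /eqP Ec; move: z; rewrite Ec /= => -> // [].
exists c, (nth 0 (0 :: x)); rewrite inE eqxx; split=> //.
  by rewrite map_nth_iota0 /= ?size_tuple // take_oversize // size_tuple.
by split=> // i; rewrite inE => /eqP->.
Qed.

Lemma representable_succ : representable Succ.
Proof.
move=> P N PN; pose c := Clause N [:: 0; 1] [::] [:: (0, 1)] [::].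
have DN : defines N [:: c] by move=> c'; rewrite inE => /eqP->.
apply: (representable_define (extends_refl PN) DN) => x y.
case/tupleP: x => a x; rewrite tuple0.
rewrite derivable_new //; split=> [[c' [env [+ + [_ s _]]]]|/= ->].
  rewrite inE => /eqP Ec; move: s; rewrite Ec /= => s [<- Ea].
  by rewrite theadE -Ea; apply: (s (0, 1)); rewrite inE.
exists c, (nth 0 [:: a.+1; a]); rewrite inE eqxx; split=> //.
by split=> // i; rewrite inE => /eqP->.
Qed.

Lemma representable_proj n (i : 'I_n) : representable (Proj i).
Proof.
move=> P N PN; pose c := Clause N (i.+1 :: iota 1 n) [::] [::] [::].
have DN : defines N [:: c] by move=> c'; rewrite inE => /eqP->.
apply: (representable_define (extends_refl PN) DN) => x y.
rewrite derivable_new //; split=> [[c' [env [+ + _]]]|/= ->].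
  rewrite inE => /eqP-> /= [<- Ex]; rewrite (tnth_nth 0) -Ex.
  by rewrite (nth_map 0) ?size_iota // nth_iota.
exists c, (nth 0 (0 :: x ++ [::])); rewrite inE eqxx; split=> //.
by rewrite /= map_nth_prefix ?size_tuple // cats0 (tnth_nth 0).
Qed.

Lemma representable_comp m n (f : murec m) (g : 'I_m -> murec n) :
  representable f -> (forall i, representable (g i)) ->
  representable (Comp f g).
Proof.
move=> Rf Rg P N PN.
have [P1 [N1 [q [ext1 lt_q Pg]]]] : exists P1 N1 (q : nat -> nat),
    [/\ extends P N P1 N1, forall i : 'I_m, q i < N1
      & forall i : 'I_m, represents P1 (q i) (g i)].
  suff H k : k <= m -> exists P1 N1 (q : nat -> nat), extends P N P1 N1 /\
      forall i : 'I_m, i < k -> q i < N1 /\ represents P1 (q i) (g i).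
    have [P1 [N1 [q [ext1 Hq]]]] := H m (leqnn m).
    by exists P1, N1, q; split=> // i; have [] := Hq i (ltn_ord i).
  elim: k => [_|k IH lt_k].
    by exists P, N, id; split=> //; apply: extends_refl.
  have [P1 [N1 [q [ext1 H]]]] := IH (ltnW lt_k).
  have [PN1 _ _] := ext1.
  have [P2 [N2 [p [ext2 lt_p Pp]]]] := Rg (Ordinal lt_k) P1 N1 PN1.
  exists P2, N2, (fun i => if i == k then p else q i).
  split=> [|i]; first exact: extends_trans ext2.
  rewrite ltnS leq_eqVlt; case: eqP => [Ei _|_ /= lt_i].
    by have -> : i = Ordinal lt_k by apply: val_inj.
  have [lt_q Pq] := H i lt_i; have [_ le12 _] := ext2.
  by split; [apply: leq_trans le12 | apply: represents_extends ext2 _ _].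
have [PN1 _ _] := ext1.
have [P2 [N2 [p [ext2 lt_p Pf]]]] := Rf P1 N1 PN1.
have {}Pg (i : 'I_m) : represents P2 (q i) (g i) by apply: represents_extends ext2 _ _.
have {}lt_q (i : 'I_m) : q i < N2 by case: ext2 => _ le12 _; apply: leq_trans le12.
pose bg (i : 'I_m) := (q i, n.+1 + i :: iota 1 n).
pose c := Clause N2 (iota 0 n.+1) [::] [::]
  ((p, 0 :: iota n.+1 m) :: [seq bg i | i <- enum 'I_m]).
have DN : defines N2 [:: c].
  move=> c'; rewrite inE => /eqP->; split=> // b; rewrite inE.
  by case/predU1P=> [->|/mapP[i _ ->]] /=; apply: ltnW.
have [PN2 _ _] := ext2.
apply: (representable_define (extends_trans ext1 ext2) DN).
have ext3 := extends_cat PN2 DN.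
have {}Pf := represents_extends ext3 lt_p Pf.
have {}Pg i := represents_extends ext3 (lt_q i) (Pg i).
move=> x y; rewrite derivable_new //; split=> [[c' [env [+ + [_ _]]]]|].
  rewrite inE => /eqP-> /= [Ey Ex] H.
  exists [tuple env (n.+1 + i) | i < m] => [i|].
    apply/Pg; rewrite tnth_mktuple -Ex; apply: (H (bg i)).
    by rewrite inE map_f ?orbT // mem_enum.
  apply/Pf; rewrite -Ey.
  have -> : tval [tuple env (n.+1 + i) | i < m] = [seq env i | i <- iota n.+1 m].
    rewrite -[n.+1]addn0 iotaDl -map_comp -val_enum_ord -map_comp.
    by apply: eq_map => i /=; rewrite addn0.
  by apply: (H (p, 0 :: iota n.+1 m)); rewrite inE eqxx.
move=> /= [z gz fz]; pose env := nth 0 (y :: x ++ z).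
have Ex : [seq env i | i <- iota 1 n] = x by apply: map_nth_prefix; rewrite size_tuple.
exists c, env; rewrite inE eqxx; split=> //; first by rewrite /= Ex.
split=> // b; rewrite inE => /predU1P[->|/mapP[i _ ->]] /=.
  by rewrite map_nth_suffix ?size_tuple //; apply/Pf.
by rewrite Ex /env nth_suffix ?size_tuple // -tnth_nth; apply/Pg.
Qed.

(** The recursion clause in terms of the sequence k :: x, whose tail would
  otherwise carry a size proof of its own. *)
Lemma eval_prec n (f : murec n) g k (x : n.-tuple nat) y :
  eval (Prec f g) [tuple of k :: x] y <->
  exists h : nat -> nat, [/\ eval f x (h 0),
    forall i, i < k -> eval g [tuple of [:: i, h i & x]] (h i.+1) & y = h k].
Proof.
have E0 : [tuple of behead [tuple of k :: x]] = x by apply: val_inj.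
have ES i a : [tuple of [:: i, a & behead [tuple of k :: x]]]
  = [tuple of [:: i, a & x]] by apply: val_inj.
split=> -[h [h0 hS ->]]; exists h; rewrite theadE in hS *; split=> //.
- by rewrite -E0.
- by move=> i /hS; rewrite ES.
- by rewrite E0.
- by move=> i /hS; rewrite ES.
Qed.

Lemma representable_prec n (f : murec n) (g : murec n.+2) :
  representable f -> representable g -> representable (Prec f g).
Proof.
move=> Rf Rg P N PN.
have [P1 [N1 [p [ext1 lt_p Pf]]]] := Rf P N PN.
have [PN1 _ _] := ext1.
have [P2 [N2 [q [ext2 lt_q Pg]]]] := Rg P1 N1 PN1.
have [PN2 _ le12] := ext2.
have {}Pf := represents_extends ext2 lt_p Pf.
have {}lt_p : p < N2 by case: ext2 => _ ? _; apply: leq_trans lt_p _.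
pose c0 := Clause N2 (iota 0 n.+2) [:: 1] [::] [:: (p, 0 :: iota 2 n)].
pose cS := Clause N2 [:: 0, 1 & iota 2 n] [::] [:: (1, n.+2)]
  [:: (N2, [:: n.+3, n.+2 & iota 2 n]); (q, [:: 0, n.+2, n.+3 & iota 2 n])].
have DN : defines N2 [:: c0; cS].
  move=> c; rewrite !inE => /orP[] /eqP->; split=> // b; rewrite !inE.
    by move/eqP->; apply: ltnW.
  by case/orP=> /eqP-> //; apply: ltnW.
apply: (representable_define (extends_trans ext1 ext2) DN).
have ext3 := extends_cat PN2 DN.
have {}Pf := represents_extends ext3 lt_p Pf.
have {}Pg := represents_extends ext3 lt_q Pg.
move=> x y; case/tupleP: x => k x; rewrite eval_prec /=.
split=> [|[h [h0 hS ->]]].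
  elim: k y => [|k IH] y; rewrite derivable_new // => -[c [env]].
    case; rewrite !inE => /orP[] /eqP-> /=.
      move=> [Ey _ Ex] [_ _ H]; exists (fun=> y); split=> //.
      by apply/Pf; rewrite -Ey -Ex; apply: (H (p, 0 :: iota 2 n)); rewrite inE.
    move=> [_ E1 _] [_ s _]; have := s (1, n.+2).
    by rewrite /= inE eqxx E1 => /(_ isT).
  case; rewrite !inE => /orP[] /eqP-> /=.
    by move=> [_ E1 _] [z _ _]; have := z 1; rewrite /= inE eqxx E1 => /(_ isT).
  move=> [Ey E1 Ex] [_ s H].
  have Ek : env n.+2 = k.
    by have := s (1, n.+2); rewrite /= inE eqxx E1 => /(_ isT) [].
  have := H (N2, _) (mem_head _ _); rewrite /= Ex Ek => /IH[h [h0 hS Eh]].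
  have Hg : eval g [tuple of [:: k, env n.+3 & x]] y.
    by apply/Pg; have := H (q, [:: 0, n.+2, n.+3 & iota 2 n]);
       rewrite /= Ex Ek Ey; apply; rewrite !inE eqxx orbT.
  pose h' i := if i <= k then h i else y.
  have h'E i : i <= k -> h' i = h i by rewrite /h' => ->.
  have h'k : h' k.+1 = y by rewrite /h' ltnn.
  exists h'; split=> // i; rewrite ltnS => le_ik; rewrite (h'E i le_ik).
  move: le_ik; rewrite leq_eqVlt => /predU1P[->|lt_ik]; first by rewrite h'k -Eh.
  by rewrite h'E //; apply: hS.
elim: k hS => [|k IH] hS; rewrite derivable_new //.
  exists c0, (nth 0 [:: h 0, 0 & x]); rewrite inE eqxx.
  have Ex := map_nth_suffix (h 0) (z := x) (erefl (size [:: 0])) (size_tuple x).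
  split=> //=; first by rewrite Ex.
  split=> // [i|b]; rewrite inE => /eqP-> //=.
  by rewrite Ex; apply/Pf.
have /IH IHk : forall i, i < k -> eval g [tuple of [:: i, h i & x]] (h i.+1).
  by move=> i lt_i; apply/hS/ltnW.
exists cS, (nth 0 (h k.+1 :: (k.+1 :: x) ++ [:: k; h k])); rewrite !inE eqxx orbT.
have Ex : [seq nth 0 (h k.+1 :: (k.+1 :: x) ++ [:: k; h k]) i | i <- iota 2 n] = x.
  have := map_nth_prefix (h k.+1) (x := k.+1 :: x) [:: k; h k] (erefl _).
  by rewrite /= size_tuple => -[].
have Ek i : nth 0 (h k.+1 :: (k.+1 :: x) ++ [:: k; h k]) (n.+2 + i) = nth 0 [:: k; h k] i.
  by rewrite nth_suffix //= size_tuple.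
have := Ek 0; have := Ek 1; rewrite addn0 addn1 /= => E1 E0.
split=> //; first by rewrite -[in RHS]Ex.
split=> // [ij|b]; rewrite !inE.
  by move=> /eqP-> /=; rewrite E0.
case/orP=> /eqP->; rewrite [X in derivable _ _ X]/= ?E0 ?E1 Ex //.
by apply/Pg/hS.
Qed.

(** An auxiliary predicate states of k and x that f takes positive values at
  i :: x for all i < k. *)
Lemma representable_mu n (f : murec n.+1) : representable f -> representable (Mu f).
Proof.
move=> Rf P N PN.
have [P1 [N1 [p [ext1 lt_p Pf]]]] := Rf P N PN.
have [PN1 _ _] := ext1.
pose c0 := Clause N1 (iota 0 n.+1) [:: 0] [::] [::].
pose cS := Clause N1 (iota 0 n.+1) [::] [:: (0, n.+1); (n.+2, n.+3)]
  [:: (N1, n.+1 :: iota 1 n); (p, [:: n.+2, n.+1 & iota 1 n])].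
have DN1 : defines N1 [:: c0; cS].
  move=> c; rewrite !inE => /orP[] /eqP->; split=> // b; rewrite !inE //.
  by case/orP=> /eqP-> //; apply: ltnW.
have ext2 := extends_cat PN1 DN1; have [PN2 _ _] := ext2.
have {}Pf := represents_extends ext2 lt_p Pf.
set P2 := P1 ++ _ in ext2 PN2 Pf.
have aux k (x : n.-tuple nat) : derivable P2 N1 (k :: x) <->
    forall i, i < k -> exists z, eval f [tuple of i :: x] z.+1.
  elim: k => [|k IH]; rewrite derivable_new //.
    split=> // _; exists c0, (nth 0 (0 :: x ++ [::])); rewrite inE eqxx.
    by split; [|rewrite /= map_nth_prefix ?size_tuple|split=> // i; rewrite inE => /eqP->].
  split=> [[c [env]]|H].
    case; rewrite !inE => /orP[] /eqP-> /=.
      by move=> [E0 _] [z _ _]; have := z 0; rewrite /= inE eqxx E0 => /(_ isT).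
    move=> [E0 Ex] [_ s Hb] i.
    have Ek : env n.+1 = k.
      by have := s (0, n.+1); rewrite /= inE eqxx E0 => /(_ isT) [].
    have Ez : env n.+2 = (env n.+3).+1.
      by apply: (s (n.+2, n.+3)); rewrite !inE eqxx orbT.
    have := Hb (N1, _) (mem_head _ _); rewrite /= Ex Ek => /IH Hk.
    rewrite ltnS leq_eqVlt => /predU1P[->|/Hk//].
    exists (env n.+3); rewrite -Ez.
    apply/Pf; have := Hb (p, [:: n.+2, n.+1 & iota 1 n]).
    by rewrite /= Ex Ek; apply; rewrite !inE eqxx orbT.
  have [z Hz] := H k (leqnn _).
  exists cS, (nth 0 (k.+1 :: x ++ [:: k; z.+1; z])); rewrite !inE eqxx orbT.
  have Ex : [seq nth 0 (k.+1 :: x ++ [:: k; z.+1; z]) i | i <- iota 1 n] = x.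
    by rewrite map_nth_prefix ?size_tuple.
  have E i := nth_suffix k.+1 [:: k; z.+1; z] i (size_tuple x).
  have := E 0; have := E 1; have := E 2.
  rewrite addn0 addn1 addn2 => {E} /= E2 E1 E0.
  split=> //; first by rewrite -[in RHS]Ex.
  split=> // [ij|b]; rewrite !inE => /orP[] /eqP->; first by rewrite /= E0.
  - by rewrite /= E1 E2.
  - by rewrite [X in derivable _ _ X]/= E0 Ex; apply/IH => i lt_i; apply/H/ltnW.
  - by rewrite [X in derivable _ _ X]/= E1 E0 Ex; apply/Pf.
pose c := Clause N1.+1 (iota 0 n.+1) [:: n.+1] [::]
  [:: (N1, iota 0 n.+1); (p, [:: n.+1, 0 & iota 1 n])].
have DN2 : defines N1.+1 [:: c].
  move=> c'; rewrite inE => /eqP->; split=> // b; rewrite !inE.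
  by case/orP=> /eqP-> //; apply/ltnW/ltnW.
have ext3 := extends_cat PN2 DN2.
apply: (representable_define (extends_trans ext1 ext2) DN2) => x y.
have {}Pf := represents_extends ext3 (ltnW lt_p) Pf.
have [_ _ E3] := ext3; rewrite derivable_new //; split.
  case=> c' [env []]; rewrite inE => /eqP-> /= [Ey Ex] [z _ Hb].
  split; last first.
    by apply/aux/E3 => //; have := Hb _ (mem_head _ _); rewrite /= Ey Ex.
  have := Hb (p, [:: n.+1, 0 & iota 1 n]).
  rewrite !inE eqxx orbT /= Ey Ex z ?inE // => /(_ isT).
  by move/(Pf [tuple of y :: x]).
case=> fy /aux/E3 Hy; exists c, (nth 0 (y :: x ++ [:: 0])); rewrite inE eqxx.
have Ex : [seq nth 0 (y :: x ++ [:: 0]) i | i <- iota 1 n] = x.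
  by rewrite map_nth_prefix ?size_tuple.
have E0 := nth_suffix y [:: 0] 0 (size_tuple x); rewrite addn0 /= in E0.
split=> //; first by rewrite /= -[in RHS]Ex.
split=> // [i|b]; first by rewrite inE => /eqP->.
rewrite !inE => /orP[] /eqP->; rewrite [X in derivable _ _ X]/= ?E0 ?Ex.
  exact: Hy.
by apply/(Pf [tuple of y :: x]).
Qed.

Theorem representableP n (f : murec n) : representable f.
Proof.
elim: f => {n}.
- exact: representable_zero.
- exact: representable_succ.
- exact: representable_proj.
- by move=> m n f Rf g Rg; apply: representable_comp.
- by move=> n f Rf g Rg; apply: representable_prec.
- exact: representable_mu.
Qed.

(** The value is projected away to make halting a unary predicate. *)
Lemma domain_derivable (f : murec 1) : exists P N p,
  [/\ preds_lt N P, p < N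
    & forall n, derivable P p [:: n] <-> exists y, eval f [tuple n] y].
Proof.
have nil_lt : preds_lt 0 [::] by move=> c; rewrite in_nil.
have [P [N [p [[PN _ _] lt_p Pf]]]] := representableP f nil_lt.
pose c := Clause N [:: 1] [::] [::] [:: (p, [:: 0; 1])].
have DN : defines N [:: c].
  move=> c'; rewrite inE => /eqP->; split=> // b; rewrite !inE => /eqP->.
  exact: ltnW.
have ext := extends_cat PN DN; have {}Pf := represents_extends ext lt_p Pf.
exists (P ++ [:: c]), N.+1, N; split=> // [|n]; first by case: ext.
rewrite derivable_new //; split.
  case=> c' [env []]; rewrite inE => /eqP-> /= [En] [_ _ H].
  exists (env 0); apply/Pf; have := H _ (mem_head _ _).
  by rewrite /= En.
case=> y fy; exists c, (nth 0 [:: y; n]); rewrite inE eqxx; split=> //.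
split=> // b; rewrite inE => /eqP->; exact/(Pf [tuple n]).
Qed.

(** * Formulas and their immediate subformulas *)

(** The induction principle that is generated for [formula] has no hypothesis
  on the subformulas, which are values of a finite function. *)
Fixpoint formula_nested_ind (S : signature) (Q : formula S -> Prop)
    (QV : forall k, Q (Var S k))
    (QA : forall (c : S) (A : {ffun 'I_(arity c) -> formula S}),
       (forall i, Q (A i)) -> Q (App A)) X : Q X :=
  match X with
  | Var k => QV k
  | App c A => QA c A (fun i => formula_nested_ind QV QA (A i))
  end.

Definition app (S : signature) (c : S) (s : seq (formula S)) : formula S :=
  App [ffun i : 'I_(arity c) => nth (Var S 0) s i].

Definition children (S : signature) (c : S) (A : {ffun 'I_(arity c) -> formula S}) :=
  [seq A i | i <- enum 'I_(arity c)].

Lemma nth_children S c (A : {ffun 'I_(arity c) -> formula S}) i (lt_i : i < arity c) :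
  nth (Var S 0) (children A) i = A (Ordinal lt_i).
Proof.
by rewrite (nth_map (Ordinal lt_i)) ?size_enum_ord // (nth_ord_enum _ (Ordinal lt_i)).
Qed.

Lemma children_ffun (S : signature) (c : S) (s : seq (formula S)) : size s = arity c ->
  children [ffun i : 'I_(arity c) => nth (Var S 0) s i] = s.
Proof.
move=> sz; apply: (@eq_from_nth _ (Var S 0)) => [|i].
  by rewrite size_map size_enum_ord.
by rewrite size_map size_enum_ord => lt_i; rewrite nth_children ffunE.
Qed.

Lemma tuple_children (S : signature) (c : S) (A : {ffun 'I_(arity c) -> formula S})
    T (v : formula S -> T) :
  [tuple v (A i) | i < arity c] = [seq v X | X <- children A] :> seq T.
Proof. by rewrite -map_comp. Qed.

Lemma nth_tuple_children (S : signature) (c : S)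
    (A : {ffun 'I_(arity c) -> formula S}) T (t0 : T) (v : formula S -> T) i :
  i < arity c ->
  nth t0 [tuple v (A i) | i < arity c] i = v (nth (Var S 0) (children A) i).
Proof.
move=> lt_i; rewrite tuple_children (nth_map (Var S 0)) //.
by rewrite size_map size_enum_ord.
Qed.

Definition bound (s : seq nat) := (foldr maxn 0 s).+1.

Lemma bound_gt s i : i \in s -> i < bound s.
Proof.
elim: s => //= a s IH; rewrite inE /bound /= ltnS => /predU1P[->|/IH].
  exact: leq_maxl.
by rewrite ltnS => /leq_trans; apply; apply: leq_maxr.
Qed.

Definition clause_vars c := head_args c ++ zeros c
  ++ [seq ij.1 | ij <- succs c] ++ [seq ij.2 | ij <- succs c]
  ++ flatten [seq b.2 | b <- body c].

Definition num_vars c := bound (clause_vars c).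

(** * The Nmatrix of a set of Horn clauses *)

Section Logic.
Variables (P : seq clause) (N goal : nat).
Hypotheses (PN : preds_lt N P) (goal_lt : goal < N).

Definition width := bound (1 :: flatten
  [seq size (head_args c) :: [seq size b.2 | b <- body c] | c <- P]).

(** Left: a successor, with the own bit of its predecessor.  Right: a derived
  fact, with its predicate and the own bits of its arguments. *)
Definition kind := (bool + 'I_N.+1 * width.-bseq bool)%type.

(** The second bit makes designation independent of what a formula encodes. *)
Definition truth := (bool * bool * kind)%type.
Definition own (w : truth) := w.1.1.
Definition des (w : truth) := w.1.2.
Definition kind_of (w : truth) := w.2.

Lemma width_gt0 : 1 <= width.
Proof. by apply: ltnW; apply: bound_gt; apply: mem_head. Qed.

Lemma size_head_args c : c \in P -> size (head_args c) <= width.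
Proof.
move=> cP; apply/ltnW/bound_gt; rewrite inE; apply/orP; right.
by apply/flatten_mapP; exists c => //; apply: mem_head.
Qed.

Lemma size_body_args c b : c \in P -> b \in body c -> size b.2 <= width.
Proof.
move=> cP bc; apply/ltnW/bound_gt; rewrite inE; apply/orP; right.
by apply/flatten_mapP; exists c => //; rewrite inE (map_f (fun b => size b.2)) ?orbT.
Qed.

Definition atom q bs : kind := inr (inord q, insub_bseq width bs).

(** The predicate N occurs in no clause, so a formula of this kind fits
  nowhere. *)
Definition junk : kind := inr (ord_max, [bseq]).
Definition truth0 : truth := (false, true, junk).

Lemma atom_inj q q' bs bs' : q < N -> q' < N -> size bs <= width ->
  size bs' <= width -> atom q bs = atom q' bs' -> q = q' /\ bs = bs'.
Proof.
move=> lt_q lt_q' le_b le_b' [Eq Eb]; split.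
  by move/(congr1 val): Eq; rewrite /= !inordK ?leqW.
have insK s : size s <= width -> insub_bseq width s = s :> seq bool.
  by move=> le_s; rewrite /insub_bseq /insubd insubT.
by rewrite -[bs]insK // -[bs']insK // Eb.
Qed.

Lemma atom_junk q bs : q < N -> atom q bs <> junk.
Proof.
move=> lt_q [/(congr1 val)]; rewrite /= inordK ?leqW // => Eq.
by rewrite Eq ltnn in lt_q.
Qed.

(** Every set of truth-values returned by a connective fixes some of the three
  components and leaves the others free; in this form it is not empty. *)
Definition demand := (option bool * option bool * option kind)%type.

Definition meets (r : demand) (w : truth) :=
  [&& if r.1.1 is Some a then own w == a else true,
      if r.1.2 is Some a then des w == a else true
    & if r.2 is Some a then kind_of w == a else true].

Definition fulfil (r : demand) (w : truth) : truth :=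
  (odflt (own w) r.1.1, odflt (des w) r.1.2, odflt (kind_of w) r.2).

Lemma fulfil_meets r w : meets r (fulfil r w).
Proof. by case: r => [[[a|] [b|]] [k|]]; rewrite /meets /= ?eqxx. Qed.

(** The Boolean is the arity: [inl false] is zero and [inl true] successor. *)
Definition conn := (bool + seq_sub P)%type.
Definition conn_arity (c : conn) : nat :=
  match c with
  | inl b => b
  | inr c => num_vars (val c) + size (body (val c))
  end.

Notation "t `_ i" := (nth truth0 t i).

(** The first [num_vars c] children are the values of the variables, the
  others are derivations of the atoms of the body.  A repeated atom refers to
  the child of its first occurrence. *)
Definition rule_ok (c : clause) (t : seq truth) :=
  [&& all (fun i => ~~ own t`_i) (zeros c),
      all (fun ij => kind_of t`_ij.1 == inl (own t`_ij.2)) (succs c)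
    & all (fun b => kind_of t`_(num_vars c + index b (body c))
                    == atom b.1 [seq own t`_i | i <- b.2]) (body c)].

Definition conn_demand (c : conn) (t : seq truth) : demand :=
  match c with
  | inl false => (Some false, None, None)
  | inl true => (None, None, Some (inl (own t`_0)))
  | inr c => (None, None, if rule_ok (val c) t then
        Some (atom (head_pred (val c)) [seq own t`_i | i <- head_args (val c)])
      else None)
  end.

Definition conn_interp (c : conn) (t : (conn_arity c).-tuple truth) :=
  [set w | meets (conn_demand c t) w].

Lemma conn_interp_neq0 c t : @conn_interp c t != set0.
Proof.
apply/set0Pn; exists (fulfil (conn_demand c t) truth0).
by rewrite inE fulfil_meets.
Qed.

(** The automaton for arguments 1, ..., n followed by a derivation of goal(n).
  The states 3 and 4 expect either the successor of a numeral whose own bit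
  is 0 or 1 respectively, or a derivation of goal for this numeral, which
  leads to 2.  The own bit of zero is 0, so 3 is initial.  In state 2 the
  letter read is the result of the connective, which is rejected in 0 if it
  is not designated.  State 1 accepts any result. *)
Definition chain_step (s : nat) (w : truth) : nat :=
  match s with
  | 0 | 1 => 1
  | 2 => des w
  | _ => if kind_of w == inl (s == 4) then 3 + own w
         else if kind_of w == atom goal [:: s == 4] then 2 else 1
  end.

Lemma chain_step_truth0 s : chain_step s truth0 != 0.
Proof. by case: s => [|[|[|s]]] //=; case: ifP. Qed.

Lemma chain_step_lt s w : chain_step s w < nstates.
Proof.
case: s => [|[|[|s]]] //=; first by case: (des w).
by case: ifP => _; [case: (own w) | case: ifP].
Qed.

Definition logic b n := wide_nmatrix [set w : truth | des w]
  conn_interp_neq0 chain_step_truth0 b n.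

(** * What all valuations agree on *)

Section Readings.
Variables (strict : bool) (n : nat).
Let M := logic strict n.
Let S := wide_signature conn_arity n.
Notation fm := (formula S).

(** The set given by the automaton, in the same form as for the other
  connectives. *)
Definition full_demand (c : S) (t : seq truth) : demand :=
  match c with
  | Some c => conn_demand c t
  | None => (None, if strict && (foldl chain_step start t == 2) then Some true
                   else None, None)
  end.

Lemma mem_interp (c : S) (t : (arity c).-tuple truth) w :
  (w \in interp (n := M) t) = meets (full_demand c t) w.
Proof.
case: c t => [c|] t; rewrite inE // /meets /=.
case: strict => //=; rewrite andbT.
case: (foldl chain_step start t =P 2) => [->|] /=; first by case: (des w).
by case: (foldl _ _ _) => [|[|[|s]]] //= _; case: ifP => //; case: ifP.
Qed.

(** The valuation that follows the wishes w in every component that is left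
  free. *)
Fixpoint reading (w : fm -> truth) (X : fm) : truth :=
  match X with
  | Var _ => w X
  | App c A => fulfil (full_demand c [tuple reading w (A i) | i < arity c]) (w X)
  end.

Lemma reading_valuation w : @valuation S M (reading w).
Proof. by move=> c A; rewrite mem_interp fulfil_meets. Qed.

Definition fzero : fm := app (Some (inl false) : S) [::].
Definition fsucc X : fm := app (Some (inl true) : S) [:: X].
Definition numeral k : fm := iter k fsucc fzero.

(** Formulas other than numerals may stand for numbers in a derivation, since
  a variable need not be constrained.  They denote numbers in a way that
  respects zero and successor, so clause instances over formulas give clause
  instances over numbers. *)
Fixpoint den (X : fm) : nat :=
  match X with
  | Var _ => 0
  | App c A =>
      if c is Some (inl true) then (\sum_(i < arity c) den (A i)).+1 else 0
  end.

Lemma den_fsucc X : den (fsucc X) = (den X).+1.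
Proof. by rewrite /= big_ord1 ffunE. Qed.

(** For fixed wishes d for the designation bits, which have no influence on
  the other components, varying the wishes for the own bits is enough to tell
  formulas apart, and junk is the only kind ever wished for. *)
Section Observe.
Variable d : fm -> bool.
Definition observe (o : fm -> bool) := reading (fun X => (o X, d X, junk)).

Definition is_fzero (X : fm) :=
  if X is App (Some (inl false)) _ then true else false.

Lemma is_fzeroP X : is_fzero X -> X = fzero.
Proof.
case: X => // -[[[]|]|] //= A _; congr App; apply/ffunP; by case.
Qed.

Lemma own_observe o X : own (observe o X) = ~~ is_fzero X && o X.
Proof. by case: X => // -[[[]|]|]. Qed.

(** Unless X is zero, the wish to have own bit 1 at X only separates X from
  any other formula. *)
Lemma own_observe_inj X Y :
  (forall o, own (observe o X) = own (observe o Y)) -> X = Y.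
Proof.
move=> H; have := H (fun=> true); rewrite !own_observe !andbT.
have [/is_fzeroP->|nzX] := boolP (is_fzero X).
  by move/esym/negbT; rewrite negbK => /is_fzeroP->.
move=> /esym nzY; have := H (fun Z => `[< X = Z >]).
rewrite !own_observe nzX nzY /= => E.
by apply/asboolP; rewrite -E; apply/asboolP.
Qed.

Lemma own_observe_false X : (forall o, own (observe o X) = false) -> X = fzero.
Proof.
move=> /(_ (fun=> true)); rewrite own_observe andbT => /negbT.
by rewrite negbK => /is_fzeroP.
Qed.

Lemma kind_observe_succ X Y :
  (forall o, kind_of (observe o X) = inl (own (observe o Y))) -> X = fsucc Y.
Proof.
case: X => [k /(_ xpredT)//|[[[]|c]|]] A H; last 3 first.
- by have := H xpredT.
- by have := H xpredT; rewrite /=; case: ifP.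
- by have := H xpredT.
congr App; apply/ffunP => i; rewrite ffunE ord1 /=.
apply: own_observe_inj => o.
have : inl (own [tuple observe o (A j) | j < arity (Some (inl true) : S)]`_0)
     = inl (own (observe o Y)) :> kind := H o.
rewrite nth_tuple_children // nth_children => -[<-].
by congr (own (observe o (A _))); apply: val_inj.
Qed.

Lemma own_observe_map_inj xs ys :
  (forall o, [seq own (observe o X) | X <- xs] = [seq own (observe o Y) | Y <- ys]) ->
  xs = ys.
Proof.
elim: xs ys => [|x xs IH] [|y ys] // H; try by have := H xpredT.
congr cons; last by apply: IH => o; have [] := H o.
by apply: own_observe_inj => o; have [] := H o.
Qed.

(** If X shows the truth-value of a fact whatever the own bits are, then its
  connective is a clause whose constraints are satisfied whatever the own
  bits are.  Equality of own bits in all these valuations is equality of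
  formulas, so the constraints hold for the formulas themselves, and the
  children that derive the body are in the same situation as X. *)
Lemma derivable_observed X q xs : q < N -> size xs <= width ->
  (forall o, kind_of (observe o X) = atom q [seq own (observe o Y) | Y <- xs]) ->
  derivable P q [seq den Y | Y <- xs].
Proof.
elim/formula_nested_ind: X q xs => [k|c A IH] q xs lt_q le_xs H.
  by have /esym/atom_junk := H xpredT; case.
case: c A IH H => [[[]|c]|] A IH H; try by have := H xpredT.
- by have /esym/atom_junk := H xpredT; case.
- pose cl := val c; have cP : cl \in P := valP c.
  pose t o : seq truth := [tuple observe o (A i) | i < conn_arity (inr c)].
  pose s := children A.
  have tE o i : i < conn_arity (inr c) -> (t o)`_i = observe o (nth (Var S 0) s i).
    exact: (@nth_tuple_children S (Some (inr c))).
  have var_lt i : i \in clause_vars cl -> i < conn_arity (inr c).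
    by move=> /bound_gt lt_i; apply: leq_trans lt_i _; apply: leq_addr.
  have {}H o : rule_ok cl (t o) /\
      atom (head_pred cl) [seq own (t o)`_i | i <- head_args cl]
      = atom q [seq own (observe o Y) | Y <- xs].
    have := H o; rewrite /observe /= -/(observe o) -/(t o).
    by case: ifP => // _ /esym/atom_junk; case.
  have headE i : i \in head_args cl -> i < conn_arity (inr c).
    by move=> hi; apply: var_lt; rewrite !mem_cat hi.
  have [lt_hd lt_body] := PN cP.
  have Eq : head_pred cl = q /\ [seq nth (Var S 0) s i | i <- head_args cl] = xs.
    have sz1 o : size [seq own (t o)`_i | i <- head_args cl] <= width.
      by rewrite size_map size_head_args.
    have sz2 o : size [seq own (observe o Y) | Y <- xs] <= width by rewrite size_map.
    have Eo o := atom_inj lt_hd lt_q (sz1 o) (sz2 o) (proj2 (H o)).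
    split; first by have [] := Eo xpredT.
    apply: own_observe_map_inj => o; have [_ <-] := Eo o.
    by rewrite -map_comp; apply/eq_in_map => i /headE lt_i; rewrite /= tE.
  case: Eq => <- <-; rewrite -map_comp.
  apply: Derive => // [i zi|ij sij|b bb] /=.
  + suff -> : nth (Var S 0) s i = fzero by [].
    apply: own_observe_false => o; have [/and3P[/allP/(_ i zi) + _ _] _] := H o.
    by rewrite tE ?var_lt ?mem_cat ?zi ?orbT // => /negbTE.
  + suff -> : nth (Var S 0) s ij.1 = fsucc (nth (Var S 0) s ij.2) by apply: den_fsucc.
    apply: kind_observe_succ => o; have [/and3P[_ /allP/(_ ij sij) + _] _] := H o.
    rewrite !tE => [/eqP//||]; apply: var_lt; rewrite !mem_cat.
      by rewrite (map_f (fun ij => ij.2)) ?orbT.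
    by rewrite (map_f (fun ij => ij.1)) ?orbT.
  + have lt_j : num_vars cl + index b (body cl) < conn_arity (inr c).
      by rewrite ltn_add2l index_mem.
    have := IH (Ordinal lt_j) b.1 [seq nth (Var S 0) s i | i <- b.2].
    rewrite -map_comp size_map; apply; [exact: lt_body|exact: size_body_args bb|] => o.
    rewrite -nth_children -tE //; have [/and3P[_ _ /allP/(_ b bb)/eqP->] _] := H o.
    congr atom; rewrite -map_comp; apply/eq_in_map => i bi /=; rewrite tE //.
    apply: var_lt; rewrite !mem_cat; do 4!(apply/orP; right).
    by apply/flatten_mapP; exists b.
- by have /esym/atom_junk := H xpredT; case.
Qed.

(** X stands for the last number read; the induction moves on to its
  successor. *)
Lemma chain_observed X xs :
  (forall o, foldl chain_step (3 + own (observe o X)) [seq observe o Y | Y <- xs] = 2) ->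
  derivable P goal [:: den X + (size xs).-1].
Proof.
have stepE (a : bool) w : chain_step (3 + a) w =
    if kind_of w == inl a then 3 + own w
    else if kind_of w == atom goal [:: a] then 2 else 1.
  by case: a.
have stuck s ws : s <= 1 -> foldl chain_step s ws != 2.
  by elim: ws s => [|w ws IH] [|[|s]] //= _; apply: IH.
elim: xs X => [|Y [|Z ys] IH] X H.
- by have := H xpredT; rewrite /=; case: (own _).
- rewrite addn0 -[[:: _]]/[seq den Z | Z <- [:: X]].
  apply: (@derivable_observed Y) => [//||o]; first exact: width_gt0.
  have : chain_step (3 + own (observe o X)) (observe o Y) = 2 := H o.
  by rewrite stepE; case: ifP => _; [case: (own _) | case: ifP => // /eqP].
- have {}H o : kind_of (observe o Y) = inl (own (observe o X)) /\
      foldl chain_step (3 + own (observe o Y)) [seq observe o Y | Y <- Z :: ys] = 2.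
    have : foldl chain_step (chain_step (3 + own (observe o X)) (observe o Y))
        [seq observe o Y | Y <- Z :: ys] = 2 := H o.
    rewrite stepE; case: ifP => [/eqP->//|_]; case: ifP => _ /eqP; last first.
      by rewrite (negPf (stuck 1 _ isT)).
    by rewrite /= (negPf (stuck _ _ _)) //; case: (des _).
  have -> : den X + (size [:: Y, Z & ys]).-1 = den Y + (size (Z :: ys)).-1.
    have -> : Y = fsucc X by apply: kind_observe_succ => o; have [] := H o.
    by rewrite den_fsucc addSnnS.
  by apply: IH => o; have [] := H o.
Qed.

End Observe.

(** * Formulas that encode derivations *)

Section Valuations.
Variable v : fm -> truth.
Hypothesis vP : @valuation S M v.

Lemma valuation_meets (c : S) (A : {ffun 'I_(arity c) -> fm}) :
  meets (full_demand c [seq v X | X <- children A]) (v (App A)).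
Proof. by have := vP A; rewrite mem_interp tuple_children. Qed.

Lemma app_meets (c : S) s : size s = arity c ->
  meets (full_demand c [seq v X | X <- s]) (v (app c s)).
Proof. by move=> sz; rewrite -[in full_demand _ _](children_ffun sz) valuation_meets. Qed.

Lemma own_fzero : own (v fzero) = false.
Proof. by have /and3P[/eqP] := @app_meets (Some (inl false)) [::] erefl. Qed.

Lemma kind_fsucc X : kind_of (v (fsucc X)) = inl (own (v X)).
Proof. by have /and3P[_ _ /eqP] := @app_meets (Some (inl true)) [:: X] erefl. Qed.

End Valuations.

(** The clause connective finds its children right in every valuation, because
  the own bit of zero and the kind of a successor are never free. *)
Lemma derivable_formula q a : derivable P q a -> exists X, forall v,
  @valuation S M v -> kind_of (v X) = atom q [seq own (v (numeral k)) | k <- a].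
Proof.
elim=> c env cP z s _ IH.
have /choice[F HF] : forall b, exists X, b \in body c -> forall v,
    @valuation S M v ->
    kind_of (v X) = atom b.1 [seq own (v (numeral k)) | k <- [seq env i | i <- b.2]].
  move=> b; have [bc|_] := boolP (b \in body c); last by exists fzero.
  by have [X HX] := IH b bc; exists X.
pose cc : S := Some (inr (SeqSub cP)).
pose xs := [seq numeral (env i) | i <- iota 0 (num_vars c)] ++ [seq F b | b <- body c].
have sz : size xs = arity cc by rewrite size_cat !size_map size_iota.
exists (app cc xs) => v vP; have /and3P[_ _] := app_meets vP sz.
rewrite /=.
set t := [seq v X | X <- xs].
have tE i : i \in clause_vars c -> t`_i = v (numeral (env i)).
  move=> /bound_gt lt_i; rewrite /t (nth_map (Var S 0)); last first.
    by rewrite sz; apply: leq_trans lt_i _; apply: leq_addr.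
  rewrite nth_cat size_map size_iota lt_i (nth_map 0) ?size_iota //.
  by rewrite nth_iota.
have -> : rule_ok c t.
  apply/and3P; split; apply/allP; [move=> i zi|move=> ij sij|move=> b bb].
  - by rewrite tE ?mem_cat ?zi ?orbT // z // own_fzero.
  - rewrite !tE ?s //; first by rewrite /= kind_fsucc.
      by rewrite !mem_cat (map_f (fun ij => ij.2)) ?orbT.
    by rewrite !mem_cat (map_f (fun ij => ij.1)) ?orbT.
  - rewrite /t (nth_map (Var S 0)); last by rewrite sz ltn_add2l index_mem.
    rewrite nth_cat size_map size_iota ltnNge leq_addr addKn.
    rewrite (nth_map b) ?index_mem // nth_index // HF //; apply/eqP; congr atom.
    rewrite -map_comp; apply/eq_in_map => i bi /=; rewrite tE //.
    rewrite !mem_cat; do 4!(apply/orP; right).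
    by apply/flatten_mapP; exists b.
move=> /eqP->; congr atom; rewrite -map_comp; apply/eq_in_map => i hi /=.
by rewrite tE // !mem_cat hi.
Qed.

Lemma accepted_formula : derivable P goal [:: n] ->
  exists s : seq fm, size s = n.+1 /\ forall v, @valuation S M v ->
    foldl chain_step start [seq v X | X <- s] = 2.
Proof.
move=> /derivable_formula[Y HY]; exists (rcons [seq numeral i | i <- iota 1 n] Y).
split=> [|v vP]; first by rewrite size_rcons size_map size_iota.
have chain k m : foldl chain_step (3 + own (v (numeral k)))
    [seq v X | X <- [seq numeral i | i <- iota k.+1 m]] = 3 + own (v (numeral (k + m))).
  elim: m k => [|m IH] k; first by rewrite addn0.
  rewrite -addSnnS -IH /= kind_fsucc //; congr foldl.
  by case: (own (v (numeral k))); rewrite eqxx.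
rewrite map_rcons foldl_rcons.
have := chain 0 n; rewrite own_fzero // addn0 add0n => ->.
have {HY} := HY v vP; rewrite /chain_step /=; case: (own _) => /= ->.
  by rewrite ?eqxx.
by rewrite ?eqxx.
Qed.

Lemma rejected_chain d (A : {ffun 'I_n.+1 -> fm}) : ~ derivable P goal [:: n] ->
  exists o, foldl chain_step start
    [seq observe d o X | X <- children (c := None : S) A] <> 2.
Proof.
move=> nd; apply: contrapT => /forallNP H; apply: nd.
have := @chain_observed d fzero (children (c := None : S) A).
rewrite /= size_map size_enum_ord; apply => o.
by have := H o; move/contrapT.
Qed.

Lemma designatedE (w : value M) : (w \in designated M) = des w.
Proof. exact: in_set. Qed.

(** A valuation that refutes the entailment of A from G not containing A
  wishes every formula but A to be designated.  The wish for A is respected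
  unless A is built with the connective of arity n.+1 and its children are
  right.  If they were right for all choices of own bits, they would contain a
  derivation of goal(n). *)
Lemma entails_trivial : (strict -> ~ derivable P goal [:: n]) ->
  forall G A, entails M G A -> G A.
Proof.
move=> nd G A GA; apply: contrapT => nGA; pose d X := ~~ `[< X = A >].
have [o Ao] : exists o, des (observe d o A) = false.
  have dA : d A = false by apply/negbTE; rewrite negbK; apply/asboolP.
  case: A @d dA {GA nGA} => [k|[c|] A] d dA.
  - by exists xpredT.
  - by exists xpredT; case: c A @d dA => [[]|c].
  have desE o : des (observe d o (App A)) =
      strict && (foldl chain_step start [seq observe d o X | X <- children A] == 2).
    by rewrite -tuple_children /observe /= -/(observe d o); case: ifP => // _; apply: dA.
  have /orP[st|nst] := orbN strict; last first.
    by exists xpredT; rewrite desE (negPf nst).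
  have [o /eqP Ho] := rejected_chain d A (nd st); exists o.
  by rewrite desE (negPf Ho) andbF.
suff : des (observe d o A) by rewrite Ao.
rewrite -designatedE; apply: GA => [|B GB]; first exact: reading_valuation.
have dB : d B by apply/asboolPn => EB; apply: nGA; rewrite -EB.
rewrite designatedE; case: B dB {GB} => [//|[[[]|c]|] B] dB //.
by rewrite /observe /=; case: ifP.
Qed.

End Readings.

Lemma same_entailmentP n :
  same_entailment (logic true n) (logic false n) <-> ~ derivable P goal [:: n].
Proof.
split=> [same|nd G A].
  move=> /(@accepted_formula true)[s [sz accept]].
  pose X := app (None : wide_signature conn_arity n) s.
  apply: (@entails_trivial false n _ (fun=> False) X) => //.
  apply/same => v vP _; rewrite designatedE.
  have := app_meets vP (c := None) sz.
  by rewrite /full_demand accept //= => /and3P[_ /eqP].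
have trivial b : entails (logic b n) G A <-> G A.
  by split=> [|GA v _]; [apply: entails_trivial | apply].
by rewrite !trivial.
Qed.

Definition logic_blueprint :=
  wide_blueprint [set w : truth | des w] conn_interp chain_step truth0.

Lemma logic_instance_code n :
  instance_code (logic true n) (logic false n) = assemble logic_blueprint n.
Proof. exact: (wide_instance_code _ _ _ chain_step_lt). Qed.

End Logic.

(** * Undecidability of equivalence *)

Lemma eval_comp1 n (f : murec 1) (g : murec n) x z y :
  eval g x z -> eval f [tuple z] y -> eval (Comp f (fun=> g)) x y.
Proof. by move=> gz fz; exists [tuple z] => // i; rewrite [i]ord1. Qed.

Theorem theorem20 :
  ~ exists f : murec 1,
      forall (S : signature) (M1 M2 : nmatrix S),
      exists b : bool,
        eval f [tuple instance_code M1 M2] (nat_of_bool b) /\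
        (b = true <-> same_entailment M1 M2).
Proof.
move=> [f fP]; have [a aP] := computable_assemble.
have [not notP] : computable 1 (fun x => if nth 0 x 0 == 0 then 1 else 0).
  by apply: computable_if0; by [exact: computable_const | exact: computable_nth].
(* The first argument is the variable of the minimization and is ignored: the
   search stops at once if f answers 1 and never if f answers 0. *)
pose decide : murec 2 :=
  Comp not (fun=> Comp f (fun=> Comp a (fun=> Proj (Ordinal (ltnSn 1))))).
have [P [N [goal [PN goal_lt haltP]]]] := domain_derivable (Mu decide).
pose e := logic_blueprint P N goal.
have [b [fb bP]] := fP _ (logic P N goal true e) (logic P N goal false e).
rewrite logic_instance_code in fb.
have decideE y z : eval decide [tuple y; e] z <-> z = ~~ b.
  have ev : eval decide [tuple y; e] (~~ b).
    apply: (eval_comp1 (z := b)).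
      apply: eval_comp1 fb; apply: eval_comp1 (aP [tuple e]).
      by rewrite /= (tnth_nth 0).
    by have := notP [tuple nat_of_bool b]; case: (b).
  by split=> [/eval_fun/(_ ev)|->].
have halts : (exists y, eval (Mu decide) [tuple e] y) <-> b.
  split=> [[y [/decideE]]|bT]; first by case: (b).
  by exists 0; split=> //; apply/decideE; rewrite bT.
have := same_entailmentP PN goal_lt e; rewrite haltP halts -bP.
by case: (b) => -[H1 H2]; [apply: H1|have := H2 notF].
Qed.
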